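(* Let $G$ be a connected $(P_2+P_3, C_4, C_6)$-free graph. Then at least one of the following holds: (1) $G$ is chordal. (2) $G$ has a pair of comparable vertices. (3) $G$ is the join of a graph $H$ and a $K_p$, where $H$ is a blowup of a $C_5$ or $H\in \mathcal{H}_1 \cup \mathcal{H}_2$, and $p\ge 0$ is an integer.
   Context: All graphs are finite, simple and undirected. $P_t$ and $C_t$ are the chordless path and cycle on $t$ vertices, $K_p$ is the complete graph on $p$ vertices ($K_0$ is empty); $P_2+P_3$ is the disjoint union of $P_2$ and $P_3$. The join $G\vee H$ is obtained from the disjoint union by adding all edges between $V(G)$ and $V(H)$. For a set of graphs $\mathcal{F}$, a graph is $\mathcal{F}$-free if it has no induced subgraph isomorphic to a member of $\mathcal{F}$. Two vertices $x,y$ are comparable if they are nonadjacent and $N(x)\subseteq N(y)$ or $N(y)\subseteq N(x)$, where $N(\cdot)$ is the open neighborhood. Disjoint vertex sets $X,Y$ are complete to each other if every vertex of $X$ is adjacent to every vertex of $Y$, and anticomplete if there are no edges between them. A blowup of a graph $G$ is obtained from $G$ by replacing each vertex with a nonempty clique, two such cliques being complete to each other if the corresponding vertices are adjacent in $G$ and anticomplete otherwise. Class $\mathcal{H}_1$: graphs whose vertex set can be partitioned into $\{u_1,\dots,u_6\}$ (six vertices) and a nonempty clique $S$ such that $u_1u_2,u_2u_3,u_4u_1,u_1u_5,u_2u_5,u_5u_6$ are edges, $S$ is complete to $\{u_3,u_4,u_6\}$, and there are no other edges. Class $\mathcal{H}_2$: graphs whose vertex set can be partitioned into an independent set $\{u,v,w\}$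 of three vertices and four mutually disjoint cliques $S_1,S_2,S_3,S_4$, where $S_1,S_2,S_4$ are nonempty and $S_3$ may be empty, such that $S_2$ is complete to $S_1\cup S_3$, $S_3$ is complete to $S_4$, $\{u\}$ is complete to $S_1\cup S_4$, $\{v\}$ is complete to $S_1\cup S_2\cup S_3$, $\{w\}$ is complete to $S_2\cup S_3\cup S_4$, and there are no other edges. *)

(* Defs.v *)
From mathcomp Require Export all_boot.

Set Implicit Arguments.
Unset Strict Implicit.
Unset Printing Implicit Defensive.

Record sgraph := SGraph {
  vertex :> finType;
  adj : rel vertex;
  adj_sym : symmetric adj;
  adj_irrefl : irreflexive adj }.

Notation "x -- y" := (adj x y) (at level 30, no associativity).

(* The simple graph generated by a relation: symmetrize and drop loops. *)
Section GraphOfRel.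
Variables (T : finType) (e : rel T).

Definition simple_rel : rel T := fun x y => (x != y) && (e x y || e y x).

Lemma simple_rel_sym : symmetric simple_rel.
Proof. by move=> x y; rewrite /simple_rel eq_sym orbC. Qed.

Lemma simple_rel_irrefl : irreflexive simple_rel.
Proof. by move=> x; rewrite /simple_rel eqxx. Qed.

Definition graph_of_rel : sgraph := SGraph simple_rel_sym simple_rel_irrefl.
End GraphOfRel.

Definition path_graph (t : nat) : sgraph :=
  graph_of_rel (fun i j : 'I_t => i.+1 == j :> nat).

(* This is the cycle C_t for t >= 3. *)
Definition cycle_graph (t : nat) : sgraph :=
  graph_of_rel (fun i j : 'I_t => i.+1 %% t == j :> nat).

Definition complete_graph (p : nat) : sgraph :=
  graph_of_rel (fun _ _ : 'I_p => true).

Section SumGraphs.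
Variables G H : sgraph.

Definition sum_rel (cross : bool) : rel (G + H)%type := fun a b =>
  match a, b with
  | inl x, inl y => x -- y
  | inr x, inr y => x -- y
  | _, _ => cross
  end.

Lemma sum_rel_sym cross : symmetric (sum_rel cross).
Proof. by case=> x [] y //=; rewrite adj_sym. Qed.

Lemma sum_rel_irrefl cross : irreflexive (sum_rel cross).
Proof. by case=> x /=; rewrite adj_irrefl. Qed.

Definition disjoint_union : sgraph :=
  SGraph (sum_rel_sym false) (sum_rel_irrefl false).

Definition join : sgraph :=
  SGraph (sum_rel_sym true) (sum_rel_irrefl true).
End SumGraphs.

Section Induced.
Variables (G : sgraph) (A : {set G}).

Definition induced_rel : rel {x : G | x \in A} := fun x y => val x -- val y.

Lemma induced_rel_sym : symmetric induced_rel.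
Proof. by move=> x y; rewrite /induced_rel adj_sym. Qed.

Lemma induced_rel_irrefl : irreflexive induced_rel.
Proof. by move=> x; rewrite /induced_rel adj_irrefl. Qed.

Definition induced : sgraph := SGraph induced_rel_sym induced_rel_irrefl.
End Induced.

Definition isomorphic (G H : sgraph) : Prop :=
  exists2 f : G -> H, bijective f & forall x y, (f x -- f y) = (x -- y).

Definition free (F : sgraph -> Prop) (G : sgraph) : Prop :=
  forall H, F H -> ~ exists A : {set G}, isomorphic (induced A) H.

Definition connected (G : sgraph) : Prop :=
  forall x y : G, connect (@adj G) x y.

Definition chordal (G : sgraph) : Prop :=
  free (fun H => exists2 t, 4 <= t & H = cycle_graph t) G.

Definition nbhd (G : sgraph) (x : G) : {set G} := [set y | x -- y].

(* Distinctness is needed: a vertex is nonadjacent to itself. *)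
Definition comparable_vertices (G : sgraph) (x y : G) : bool :=
  [&& x != y, ~~ (x -- y) & (nbhd x \subset nbhd y) || (nbhd y \subset nbhd x)].

Section VertexSets.
Variable G : sgraph.
Implicit Types A B : {set G}.

Definition clique A : Prop := {in A &, forall x y, x != y -> x -- y}.
Definition complete_to A B : Prop := {in A & B, forall x y, x -- y}.
Definition anticomplete_to A B : Prop := {in A & B, forall x y, ~~ (x -- y)}.

(* The sets listed in s (some possibly empty) partition V(G). *)
Definition splits (s : seq {set G}) : Prop :=
  forall x : G, count (fun A => x \in A) s = 1.

(* Each pair (A, B) in s makes A complete to B, a pair (A, A) makes A a clique,
   and G has no other edges. *)
Definition edges_exactly (s : seq ({set G} * {set G})) : Prop :=
  let listed (x y : G) :=
    has (fun p : {set G} * {set G} => (x \in p.1) && (y \in p.2)) s in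
  forall x y : G, (x -- y) = simple_rel listed x y.
End VertexSets.

(* H is a blowup of G. *)
Definition blowup (G H : sgraph) : Prop :=
  exists Q : G -> {set H},
    [/\ forall x : H, exists! v, x \in Q v,
        forall v, Q v != set0,
        forall v, clique (Q v)
      & forall v w, v != w ->
          if v -- w then complete_to (Q v) (Q w)
          else anticomplete_to (Q v) (Q w)].

Definition class_H1 (H : sgraph) : Prop :=
  exists (u1 u2 u3 u4 u5 u6 : H) (S : {set H}),
    [/\ splits [:: [set u1]; [set u2]; [set u3]; [set u4]; [set u5]; [set u6];
                   S],
        S != set0
      & edges_exactly
          [:: ([set u1], [set u2]); ([set u2], [set u3]);
              ([set u4], [set u1]); ([set u1], [set u5]);
              ([set u2], [set u5]); ([set u5], [set u6]);
              (S, S); (S, [set u3; u4; u6])]].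

Definition class_H2 (H : sgraph) : Prop :=
  exists (u v w : H) (S1 S2 S3 S4 : {set H}),
    [/\ splits [:: [set u]; [set v]; [set w]; S1; S2; S3; S4],
        [/\ S1 != set0, S2 != set0 & S4 != set0]
      & edges_exactly
          [:: (S1, S1); (S2, S2); (S3, S3); (S4, S4);
              (S2, S1 :|: S3); (S3, S4);
              ([set u], S1 :|: S4);
              ([set v], S1 :|: S2 :|: S3);
              ([set w], S2 :|: S3 :|: S4)]].

(* Main.v *)
(* Suppose there are no comparable vertices. An induced cycle of length at least
   7 contains P2 + P3, so if G is not chordal it has an induced C5, say
   v1 ... v5. By C4-freeness every vertex x sees on this cycle: everything
   ("full"), the two neighbours of some vi but not their other neighbours
   ("clone" of vi), exactly one edge ("opposite" to the vertex vi farthest from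
   that edge), exactly one vertex ("pendant"), or nothing ("remote"). Remote
   vertices have only full neighbours, so they are comparable to v1.

   If no induced C5 has an opposite vertex, then a pendant vertex at v1 would be
   comparable to v2, and nonadjacent clones of v1 and v2 would give a C5 with an
   opposite vertex; so the non-full vertices form a blowup of C5.

   Otherwise let b be opposite to v1. It is the only opposite vertex of this C5,
   and all pendants are at v1. If there is a pendant, the clones of v2, ..., v5
   are trivial and H1 arises. If not, b cannot have neighbours among the clones
   of both v2 and v5, and H2 arises.

   In all cases the full vertices are universal; for b and the pendant this uses
   once more that they are not comparable to a full vertex. *)

Require Import Defs.

Set Implicit Arguments.
Unset Strict Implicit.

(** * Forbidden patterns, and positions of a vertex relative to an induced C5 *)

Section Patterns.
Variable G : sgraph.
Implicit Types v x y p q r s t : G.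

(** The two ends of a P3 have the same neighbours, hence the explicit [r != t]; all other pairs are
    told apart by adjacencies. Opposite vertices of a C4 are treated likewise in [no_C4], while in a
    C6 adjacencies separate all pairs. *)
Definition no_P2P3 := forall p q r s t,
  p -- q -> r -- s -> s -- t -> r != t -> ~~ (r -- t) ->
  ~~ (p -- r) -> ~~ (p -- s) -> ~~ (p -- t) ->
  ~~ (q -- r) -> ~~ (q -- s) -> ~~ (q -- t) -> False.

Definition no_C4 := forall p q r s,
  p -- q -> q -- r -> r -- s -> s -- p -> p != r -> q != s ->
  ~~ (p -- r) -> ~~ (q -- s) -> False.

(** One inclusion suffices, since the quantifiers range over ordered pairs. *)
Definition no_comparable := forall x y : G,
  x != y -> ~~ (x -- y) -> (forall z, x -- z -> y -- z) -> False.

Definition no_C6 := forall p q r s t u : G,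
  p -- q -> q -- r -> r -- s -> s -- t -> t -- u -> u -- p ->
  ~~ (p -- r) -> ~~ (p -- s) -> ~~ (p -- t) ->
  ~~ (q -- s) -> ~~ (q -- t) -> ~~ (q -- u) ->
  ~~ (r -- t) -> ~~ (r -- u) -> ~~ (s -- u) -> False.

Definition c5 v1 v2 v3 v4 v5 : bool :=
  [&& v1 -- v2, v2 -- v3, v3 -- v4, v4 -- v5, v5 -- v1,
      ~~ (v1 -- v3), ~~ (v2 -- v4), ~~ (v3 -- v5), ~~ (v4 -- v1)
    & ~~ (v5 -- v2)].

(* No condition on v1, so that v1 is a clone of itself. *)
Definition clone v1 v2 v3 v4 v5 x : bool :=
  [&& x -- v2, ~~ (x -- v3), ~~ (x -- v4) & x -- v5].

Definition full v1 v2 v3 v4 v5 x : bool :=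
  [&& x -- v1, x -- v2, x -- v3, x -- v4 & x -- v5].

Definition opposite v1 v2 v3 v4 v5 x : bool :=
  [&& ~~ (x -- v1), ~~ (x -- v2), x -- v3, x -- v4 & ~~ (x -- v5)].

Definition pendant v1 v2 v3 v4 v5 x : bool :=
  [&& x -- v1, ~~ (x -- v2), ~~ (x -- v3), ~~ (x -- v4) & ~~ (x -- v5)].

Definition remote v1 v2 v3 v4 v5 x : bool :=
  [&& ~~ (x -- v1), ~~ (x -- v2), ~~ (x -- v3), ~~ (x -- v4)
    & ~~ (x -- v5)].

Lemma adjN_neq r x y : x -- r -> ~~ (y -- r) -> x != y.
Proof. by move=> xr; apply: contraNneq => <-. Qed.

End Patterns.

Unset Implicit Arguments.

(** * Automation: reading adjacencies and inequalities off the context *)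

Ltac atoms :=
  repeat match goal with
  | H : is_true (c5 _ _ _ _ _) |- _ => unfold c5 in H
  | H : is_true (clone _ _ _ _ _ _) |- _ => unfold clone in H
  | H : is_true (full _ _ _ _ _ _) |- _ => unfold full in H
  | H : is_true (opposite _ _ _ _ _ _) |- _ => unfold opposite in H
  | H : is_true (pendant _ _ _ _ _ _) |- _ => unfold pendant in H
  | H : is_true (remote _ _ _ _ _ _) |- _ => unfold remote in H
  | H : is_true (_ && _) |- _ =>
      let H1 := fresh "H" in let H2 := fresh "H" in
      case/andP: H => H1 H2
  end.

(* Purely syntactic: [assumption] would unify up to conversion and be slow. *)
Ltac adjacency :=
  lazymatch goal with
  | H : is_true (?x -- ?y) |- is_true (?x -- ?y) => exact H
  | H : is_true (?y -- ?x) |- is_true (?x -- ?y) => rewrite adj_sym; exact H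
  | H : is_true (~~ (?x -- ?y)) |- is_true (~~ (?x -- ?y)) => exact H
  | H : is_true (~~ (?y -- ?x)) |- is_true (~~ (?x -- ?y)) =>
      rewrite adj_sym; exact H
  | |- is_true (~~ (?x -- ?x)) => rewrite adj_irrefl; exact isT
  end.

(** Two vertices are told apart by a third one adjacent to exactly one of them. *)
Ltac distinct :=
  match goal with
  | H : is_true (?x != ?y) |- is_true (?x != ?y) => exact H
  | H : is_true (?y != ?x) |- is_true (?x != ?y) => rewrite eq_sym; exact H
  | r : Finite.sort (vertex _) |- is_true (?x != ?y) =>
      solve [ apply: (adjN_neq (r := r)); adjacency
            | rewrite eq_sym; apply: (adjN_neq (r := r)); adjacency ]
  end.

Ltac decide_atoms :=
  atoms; rewrite /clone /full /opposite /pendant /remote /c5;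
  repeat match goal with
  | |- is_true (_ && _) => apply/andP; split
  end;
  first [ adjacency | distinct ].

(** The arguments exhibit the forbidden subgraph: the edge [p q], then the path [r s t] in order. In
    [cyc4] and [cyc6] they are listed along the cycle. *)
Ltac p2p3 p q r s t :=
  atoms;
  match goal with H : no_P2P3 _ |- _ =>
    refine (H p q r s t _ _ _ _ _ _ _ _ _ _ _); decide_atoms
  end.

Ltac cyc4 p q r s :=
  atoms;
  match goal with H : no_C4 _ |- _ =>
    refine (H p q r s _ _ _ _ _ _ _ _); decide_atoms
  end.

Ltac cyc6 p q r s t u :=
  atoms;
  match goal with H : no_C6 _ |- _ =>
    refine (H p q r s t u _ _ _ _ _ _ _ _ _ _ _ _ _ _ _); decide_atoms
  end.

Ltac evaluate :=
  repeat match goal with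
  | |- context [?x == ?x] => rewrite eqxx
  | |- context [?x == ?y] => have/negbTE -> : x != y by distinct
  | H : is_true (?x -- ?y) |- context [?x -- ?y] => rewrite H
  | H : is_true (?x -- ?y) |- context [?y -- ?x] => rewrite (adj_sym y x) H
  | H : is_true (~~ (?x -- ?y)) |- context [?x -- ?y] => rewrite (negbTE H)
  | H : is_true (~~ (?x -- ?y)) |- context [?y -- ?x] =>
      rewrite (adj_sym y x) (negbTE H)
  | |- context [?x -- ?x] => rewrite adj_irrefl
  end.

(** * Types of vertices around an induced C5 and adjacencies between them *)

Section Structure.
Variable G : sgraph.
Implicit Types v x y p q r s t : G.
Hypothesis noP : no_P2P3 G.
Hypothesis noC4 : no_C4 G.
Hypothesis noC6 : no_C6 G.

Section FixedCycle.
Variables v1 v2 v3 v4 v5 : G.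
Lemma clone_adj x : c5 v1 v2 v3 v4 v5 ->
  clone v1 v2 v3 v4 v5 x -> x != v1 -> x -- v1.
Proof. by move=> Cv Hx xv1; apply/negP => /negP nx; cyc4 x v5 v1 v2. Qed.

Variant c5_spec x : Prop :=
| IsRemote of remote v1 v2 v3 v4 v5 x
| IsFull of full v1 v2 v3 v4 v5 x
| IsClone1 of clone v1 v2 v3 v4 v5 x
| IsClone2 of clone v2 v3 v4 v5 v1 x
| IsClone3 of clone v3 v4 v5 v1 v2 x
| IsClone4 of clone v4 v5 v1 v2 v3 x
| IsClone5 of clone v5 v1 v2 v3 v4 x
| IsOpposite1 of opposite v1 v2 v3 v4 v5 x
| IsOpposite2 of opposite v2 v3 v4 v5 v1 x
| IsOpposite3 of opposite v3 v4 v5 v1 v2 x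
| IsOpposite4 of opposite v4 v5 v1 v2 v3 x
| IsOpposite5 of opposite v5 v1 v2 v3 v4 x
| IsPendant1 of pendant v1 v2 v3 v4 v5 x
| IsPendant2 of pendant v2 v3 v4 v5 v1 x
| IsPendant3 of pendant v3 v4 v5 v1 v2 x
| IsPendant4 of pendant v4 v5 v1 v2 v3 x
| IsPendant5 of pendant v5 v1 v2 v3 v4 x.

(** Each of the ten excluded patterns misses some vi but contains both cycle neighbours of vi and a
    further cycle vertex. The latter shows that [x] is not vi, so [x], vi and the two neighbours
    induce a C4. *)
Lemma c5_cases x : c5 v1 v2 v3 v4 v5 ->
  c5_spec x.
Proof.
move=> Cv.
have [x1|x1] := boolP (x -- v1); have [x2|x2] := boolP (x -- v2);
have [x3|x3] := boolP (x -- v3); have [x4|x4] := boolP (x -- v4);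
have [x5|x5] := boolP (x -- v5);
first [ solve [constructor; decide_atoms]
      | exfalso; first
        [ cyc4 x v5 v1 v2 | cyc4 x v1 v2 v3 | cyc4 x v2 v3 v4
        | cyc4 x v3 v4 v5 | cyc4 x v4 v5 v1 ]].
Qed.

Lemma clone_clique x y : c5 v1 v2 v3 v4 v5 ->
  clone v1 v2 v3 v4 v5 x -> clone v1 v2 v3 v4 v5 y ->
  x != y -> x -- y.
Proof. by move=> Cv Hx Hy xy; apply/negP => /negP nxy; cyc4 x v5 y v2. Qed.

Lemma clone_anti x y : c5 v1 v2 v3 v4 v5 ->
  clone v1 v2 v3 v4 v5 x -> clone v3 v4 v5 v1 v2 y ->
  ~~ (x -- y).
Proof. by move=> Cv Hx Hy; apply/negP => xy; cyc4 x y v4 v5. Qed.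

Lemma full_clique x y : c5 v1 v2 v3 v4 v5 ->
  full v1 v2 v3 v4 v5 x -> full v1 v2 v3 v4 v5 y ->
  x != y -> x -- y.
Proof. by move=> Cv Hx Hy xy; apply/negP => /negP nxy; cyc4 x v1 y v3. Qed.

Lemma full_clone x y : c5 v1 v2 v3 v4 v5 ->
  full v1 v2 v3 v4 v5 x -> clone v1 v2 v3 v4 v5 y ->
  x -- y.
Proof. by move=> Cv Hx Hy; apply/negP => /negP nxy; cyc4 x v5 y v2. Qed.

Lemma remote_clone x y : c5 v1 v2 v3 v4 v5 ->
  remote v1 v2 v3 v4 v5 x -> clone v1 v2 v3 v4 v5 y ->
  ~~ (x -- y).
Proof.
move=> Cv Hx Hy; apply/negP => xy.
have yv1: y -- v1 by apply: clone_adj => //; decide_atoms.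
by p2p3 v3 v4 x y v1.
Qed.

Lemma pendant_clone1 x y : c5 v1 v2 v3 v4 v5 ->
  pendant v1 v2 v3 v4 v5 x ->
  clone v1 v2 v3 v4 v5 y -> x -- y.
Proof.
move=> Cv Hx Hy; have [->|yv1] := eqVneq y v1; first by atoms.
have := clone_adj y Cv Hy yv1 => yv1'.
by apply/negP => /negP nxy; p2p3 v3 v4 x v1 y.
Qed.

Lemma pendant_clone2 x y : c5 v1 v2 v3 v4 v5 ->
  pendant v1 v2 v3 v4 v5 x ->
  clone v3 v4 v5 v1 v2 y -> ~~ (x -- y).
Proof. by move=> Cv Hx Hy; apply/negP => xy; cyc4 x y v2 v1. Qed.

Lemma pendant_pendant x y : c5 v1 v2 v3 v4 v5 ->
  pendant v1 v2 v3 v4 v5 x ->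
  pendant v1 v2 v3 v4 v5 y -> x = y.
Proof.
move=> Cv Hx Hy; apply/eqP/negPn/negP => nxy.
have [xy|xy] := boolP (x -- y); first by p2p3 x y v2 v3 v4.
by p2p3 v3 v4 x v1 y.
Qed.

Lemma pendant_pendant1 x y : c5 v1 v2 v3 v4 v5 ->
  pendant v1 v2 v3 v4 v5 x ->
  pendant v2 v3 v4 v5 v1 y -> ~~ (x -- y).
Proof. by move=> Cv Hx Hy; apply/negP => xy; p2p3 x y v3 v4 v5. Qed.

(** If [x] and [y] are adjacent, they can replace [v2] and lengthen the cycle to a C6. *)
Lemma pendant_pendant2 x y : c5 v1 v2 v3 v4 v5 ->
  pendant v1 v2 v3 v4 v5 x ->
  pendant v3 v4 v5 v1 v2 y -> False.
Proof.
move=> Cv Hx Hy; have [xy|xy] := boolP (x -- y); last by p2p3 y v3 x v1 v5.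
by cyc6 x y v3 v4 v5 v1.
Qed.

Lemma opposite_unique x y : c5 v1 v2 v3 v4 v5 ->
  opposite v1 v2 v3 v4 v5 x ->
  opposite v1 v2 v3 v4 v5 y -> x = y.
Proof.
move=> Cv Hx Hy; apply/eqP/negPn/negP => nxy.
have [xy|xy] := boolP (x -- y); first by p2p3 x y v2 v1 v5.
by p2p3 v1 v5 x v3 y.
Qed.

Lemma opposite_opposite1 x y : c5 v1 v2 v3 v4 v5 ->
  opposite v1 v2 v3 v4 v5 x ->
  opposite v2 v3 v4 v5 v1 y -> False.
Proof.
move=> Cv Hx Hy; have [xy|xy] := boolP (x -- y); last by p2p3 v1 v2 x v4 y.
by cyc6 x y v5 v1 v2 v3.
Qed.

Lemma opposite_opposite2 x y : c5 v1 v2 v3 v4 v5 ->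
  opposite v1 v2 v3 v4 v5 x ->
  opposite v3 v4 v5 v1 v2 y -> False.
Proof.
move=> Cv Hx Hy; have [xy|xy] := boolP (x -- y); last by p2p3 x v4 y v1 v2.
by cyc4 x v4 v5 y.
Qed.

Lemma opposite_clone1 x y : c5 v1 v2 v3 v4 v5 ->
  opposite v1 v2 v3 v4 v5 x ->
  clone v1 v2 v3 v4 v5 y -> ~~ (x -- y).
Proof. by move=> Cv Hx Hy; apply/negP => xy; cyc4 x y v5 v4. Qed.

Lemma opposite_pendant1 x y : c5 v1 v2 v3 v4 v5 ->
  opposite v1 v2 v3 v4 v5 x ->
  pendant v2 v3 v4 v5 v1 y -> False.
Proof.
move=> Cv Hx Hy; have [xy|xy] := boolP (x -- y); first by cyc4 x y v2 v3.
by p2p3 y v2 x v4 v5.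
Qed.

Lemma opposite_pendant2 x y : c5 v1 v2 v3 v4 v5 ->
  opposite v1 v2 v3 v4 v5 x ->
  pendant v3 v4 v5 v1 v2 y -> False.
Proof.
move=> Cv Hx Hy; have [xy|xy] := boolP (x -- y); first by p2p3 x y v2 v1 v5.
by p2p3 v1 v5 y v3 x.
Qed.

End FixedCycle.

(** A missed clone would form the path [x v3 y] beside the edge [v1 v5]. The cycle is a parameter
    here because [clone_adj] is applied to a rotation of it. *)
Lemma opposite_clone3 v1 v2 v3 v4 v5 x y : c5 v1 v2 v3 v4 v5 ->
  opposite v1 v2 v3 v4 v5 x -> clone v3 v4 v5 v1 v2 y -> x -- y.
Proof.
move=> Cv Hx Hy; have [->|yv3] := eqVneq y v3; first by atoms.
have yv3' : y -- v3.
  by apply: (@clone_adj v3 v4 v5 v1 v2) => //; decide_atoms.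
by apply/negP => /negP nxy; p2p3 v1 v5 x v3 y.
Qed.

Lemma pendant_clone3 v1 v2 v3 v4 v5 x y : c5 v1 v2 v3 v4 v5 ->
  pendant v1 v2 v3 v4 v5 x -> clone v2 v3 v4 v5 v1 y -> ~~ (x -- y).
Proof.
move=> Cv Hx Hy; apply/negP => xy.
have yv2 : y -- v2.
  by apply: (@clone_adj v2 v3 v4 v5 v1) => //; decide_atoms.
by p2p3 v4 v5 x y v2.
Qed.


(** A neighbour [y] that is remote, opposite or pendant misses a P3 of the cycle, which together
    with the edge [x y] is a P2+P3. Clones are handled by [remote_clone]. *)
Lemma remote_nbr v1 v2 v3 v4 v5 x y : c5 v1 v2 v3 v4 v5 ->
  remote v1 v2 v3 v4 v5 x -> x -- y -> full v1 v2 v3 v4 v5 y.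
Proof.
move=> Cv Hx xy; case: (c5_cases v1 v2 v3 v4 v5 y Cv) => // Hy; exfalso;
first [ p2p3 x y v1 v2 v3 | p2p3 x y v2 v3 v4 | p2p3 x y v3 v4 v5
      | p2p3 x y v4 v5 v1 | p2p3 x y v5 v1 v2
      | apply: (negP _ xy);
        first [ refine (remote_clone v1 v2 v3 v4 v5 x y _ _ _); decide_atoms
              | refine (remote_clone v2 v3 v4 v5 v1 x y _ _ _); decide_atoms
              | refine (remote_clone v3 v4 v5 v1 v2 x y _ _ _); decide_atoms
              | refine (remote_clone v4 v5 v1 v2 v3 x y _ _ _); decide_atoms
              | refine (remote_clone v5 v1 v2 v3 v4 x y _ _ _); decide_atoms ]].
Qed.

(** * Consequences of having no comparable vertices *)

Hypothesis noComp : no_comparable G.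

Lemma remoteN v1 v2 v3 v4 v5 x : c5 v1 v2 v3 v4 v5 ->
  ~~ remote v1 v2 v3 v4 v5 x.
Proof.
move=> Cv; apply/negP => Hx; apply: (noComp x v1).
- by atoms; distinct.
- by atoms.
- move=> z xz; have Hz := remote_nbr _ _ _ _ _ _ _ Cv Hx xz.
  by atoms; adjacency.
Qed.

Lemma pendant_nbr v1 v2 v3 v4 v5 x z : c5 v1 v2 v3 v4 v5 ->
  pendant v1 v2 v3 v4 v5 x -> x -- z ->
  [|| full v1 v2 v3 v4 v5 z, clone v1 v2 v3 v4 v5 z
    | opposite v1 v2 v3 v4 v5 z].
Proof.
move=> Cv Hx xz; have nz := remoteN v1 v2 v3 v4 v5 z Cv.
(* Reversing the cycle about [v1] keeps [x] pendant at [v1], so each lemma also yields its mirror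
   image. *)
have Cr : c5 v1 v5 v4 v3 v2 by decide_atoms.
have Hxr : pendant v1 v5 v4 v3 v2 x by decide_atoms.
case: (c5_cases v1 v2 v3 v4 v5 z Cv) => Hz.
- by rewrite Hz in nz.
- by rewrite Hz.
- by rewrite Hz orbT.
- by case/negP: (pendant_clone3 _ _ _ _ _ _ _ Cv Hx Hz).
- by case/negP: (pendant_clone2 _ _ _ _ _ _ _ Cv Hx Hz).
- have nxz : ~~ (x -- z).
    by refine (pendant_clone2 v1 v5 v4 v3 v2 x z Cr Hxr _); decide_atoms.
  by rewrite xz in nxz.
- have nxz : ~~ (x -- z).
    by refine (pendant_clone3 v1 v5 v4 v3 v2 x z Cr Hxr _); decide_atoms.
  by rewrite xz in nxz.
- by rewrite Hz !orbT.
- case: (opposite_pendant1 v2 v1 v5 v4 v3 z x); decide_atoms.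
- case: (opposite_pendant2 v3 v2 v1 v5 v4 z x); decide_atoms.
- case: (opposite_pendant2 v4 v5 v1 v2 v3 z x); decide_atoms.
- case: (opposite_pendant1 v5 v1 v2 v3 v4 z x); decide_atoms.
- have xz' := pendant_pendant _ _ _ _ _ _ _ Cv Hx Hz.
  by move: xz; rewrite -xz' adj_irrefl.
- by case/negP: (pendant_pendant1 _ _ _ _ _ _ _ Cv Hx Hz).
- by case: (pendant_pendant2 _ _ _ _ _ _ _ Cv Hx Hz).
- case: (pendant_pendant2 v1 v5 v4 v3 v2 x z Cr Hxr _); decide_atoms.
- have nxz : ~~ (x -- z).
    by refine (pendant_pendant1 v1 v5 v4 v3 v2 x z Cr Hxr _); decide_atoms.
  by rewrite xz in nxz.
Qed.

(** * Graphs in which no induced C5 has an opposite vertex *)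

Section NoOpposite.
Hypothesis noOpp : forall v1 v2 v3 v4 v5 x,
  c5 v1 v2 v3 v4 v5 -> ~~ opposite v1 v2 v3 v4 v5 x.

Lemma pendantN v1 v2 v3 v4 v5 x : c5 v1 v2 v3 v4 v5 ->
  ~~ pendant v1 v2 v3 v4 v5 x.
Proof.
move=> Cv; apply/negP => Hx; apply: (noComp x v2).
- by atoms; distinct.
- by atoms.
move=> z xz; case/or3P: (pendant_nbr _ _ _ _ _ _ _ Cv Hx xz) => Hz.
- by atoms; adjacency.
- by atoms; adjacency.
by case/negP: (noOpp v1 v2 v3 v4 v5 z Cv).
Qed.

Lemma clone_complete v1 v2 v3 v4 v5 x y : c5 v1 v2 v3 v4 v5 ->
  clone v1 v2 v3 v4 v5 x -> clone v2 v3 v4 v5 v1 y -> x -- y.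
Proof.
move=> Cv Hx Hy; apply/negP => /negP nxy.
have yv2 : y != v2.
  by apply: contraNneq nxy => ->; move: Hx; rewrite /clone; case/andP.
have yv2' : y -- v2 by refine (clone_adj v2 v3 v4 v5 v1 y _ _ _); decide_atoms.
(* With [x] in place of [v1] the cycle is still an induced C5, and [y] sees only its edge [v2 v3],
   so [y] is opposite to [v5]. *)
by refine (negP (noOpp v5 x v2 v3 v4 y _) _); decide_atoms.
Qed.

Lemma blowup_cases v1 v2 v3 v4 v5 x : c5 v1 v2 v3 v4 v5 ->
  ~~ full v1 v2 v3 v4 v5 x ->
  [|| clone v1 v2 v3 v4 v5 x, clone v2 v3 v4 v5 v1 x,
      clone v3 v4 v5 v1 v2 x, clone v4 v5 v1 v2 v3 x
    | clone v5 v1 v2 v3 v4 x].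
Proof.
move=> Cv nx; have rx := remoteN v1 v2 v3 v4 v5 x Cv.
have C2 : c5 v2 v3 v4 v5 v1 by decide_atoms.
have C3 : c5 v3 v4 v5 v1 v2 by decide_atoms.
have C4 : c5 v4 v5 v1 v2 v3 by decide_atoms.
have C5 : c5 v5 v1 v2 v3 v4 by decide_atoms.
case: (c5_cases v1 v2 v3 v4 v5 x Cv) => Hx; rewrite ?Hx ?orbT //.
- by rewrite Hx in rx.
- by rewrite Hx in nx.
all: exfalso; first [ apply: (negP (noOpp _ _ _ _ _ x _) Hx); assumption
                    | apply: (negP (pendantN _ _ _ _ _ x _) Hx); assumption ].
Qed.

End NoOpposite.

(** * An induced C5 with an opposite vertex *)

Section Opposite.
Variables v1 v2 v3 v4 v5 b : G.

Variant opposite_spec x : Prop :=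
| OppFull of full v1 v2 v3 v4 v5 x
| OppClone1 of clone v1 v2 v3 v4 v5 x
| OppClone2 of clone v2 v3 v4 v5 v1 x
| OppClone3 of clone v3 v4 v5 v1 v2 x
| OppClone4 of clone v4 v5 v1 v2 v3 x
| OppClone5 of clone v5 v1 v2 v3 v4 x
| OppSelf of x = b
| OppPendant of pendant v1 v2 v3 v4 v5 x.

Lemma opposite_cases x : c5 v1 v2 v3 v4 v5 -> opposite v1 v2 v3 v4 v5 b ->
  opposite_spec x.
Proof.
move=> Cv Hb; have rx := remoteN v1 v2 v3 v4 v5 x Cv.
case: (c5_cases v1 v2 v3 v4 v5 x Cv) => Hx; try by constructor.
- by rewrite Hx in rx.
- by constructor; apply: (opposite_unique v1 v2 v3 v4 v5).
- by case: (opposite_opposite1 v1 v2 v3 v4 v5 b x).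
- by case: (opposite_opposite2 v1 v2 v3 v4 v5 b x).
- case: (opposite_opposite2 v1 v5 v4 v3 v2 b x); decide_atoms.
- case: (opposite_opposite1 v1 v5 v4 v3 v2 b x); decide_atoms.
- by case: (opposite_pendant1 v1 v2 v3 v4 v5 b x).
- by case: (opposite_pendant2 v1 v2 v3 v4 v5 b x).
- case: (opposite_pendant2 v1 v5 v4 v3 v2 b x); decide_atoms.
- case: (opposite_pendant1 v1 v5 v4 v3 v2 b x); decide_atoms.
Qed.

(** Otherwise [b x v1 y] is a C4. This decides in which direction the cycle is read when H2
    arises. *)
Lemma opposite_clone25 x y : c5 v1 v2 v3 v4 v5 ->
  clone v5 v1 v2 v3 v4 x -> clone v2 v3 v4 v5 v1 y ->
  b -- x -> b -- y -> opposite v1 v2 v3 v4 v5 b -> False.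
Proof.
move=> Cv Hx Hy bx yb Hb.
have nxy : ~~ (x -- y).
  by apply: (clone_anti v5 v1 v2 v3 v4) => //; decide_atoms.
by cyc4 b x v1 y.
Qed.

End Opposite.

Lemma full_clone_any v1 v2 v3 v4 v5 t x : c5 v1 v2 v3 v4 v5 ->
  full v1 v2 v3 v4 v5 t ->
  [|| clone v1 v2 v3 v4 v5 x, clone v2 v3 v4 v5 v1 x,
      clone v3 v4 v5 v1 v2 x, clone v4 v5 v1 v2 v3 x
    | clone v5 v1 v2 v3 v4 x] -> t -- x.
Proof.
move=> Cv Ht; case/or4P => [Hx|Hx|Hx|/orP[Hx|Hx]].
- by refine (full_clone v1 v2 v3 v4 v5 t x _ _ _); decide_atoms.
- by refine (full_clone v2 v3 v4 v5 v1 t x _ _ _); decide_atoms.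
- by refine (full_clone v3 v4 v5 v1 v2 t x _ _ _); decide_atoms.
- by refine (full_clone v4 v5 v1 v2 v3 t x _ _ _); decide_atoms.
- by refine (full_clone v5 v1 v2 v3 v4 t x _ _ _); decide_atoms.
Qed.

(** If [t] misses [b], it still sees all neighbours of [b], making the two comparable: a pendant
    neighbour [z] of [b] missed by [t] would give the edge [b z] beside the path [v2 t v5]. *)
Lemma opposite_full v1 v2 v3 v4 v5 b t : c5 v1 v2 v3 v4 v5 ->
  opposite v1 v2 v3 v4 v5 b -> full v1 v2 v3 v4 v5 t -> t -- b.
Proof.
move=> Cv Hb Ht; apply/negP => /negP ntb; apply: (noComp b t).
- by atoms; distinct.
- by adjacency.
move=> z bz.
case: (opposite_cases v1 v2 v3 v4 v5 b z Cv Hb) => Hz;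
  try by apply: (full_clone_any _ _ _ _ _ _ _ Cv Ht); rewrite Hz ?orbT.
- have tz : t != z by apply: contraNneq ntb => ->; adjacency.
  exact: full_clique Hz tz.
- by move: bz; rewrite Hz adj_irrefl.
- by apply/negP => /negP ntz; p2p3 b z v2 t v5.
Qed.

Lemma pendant_full v1 v2 v3 v4 v5 d t : c5 v1 v2 v3 v4 v5 ->
  pendant v1 v2 v3 v4 v5 d -> full v1 v2 v3 v4 v5 t -> t -- d.
Proof.
move=> Cv Hd Ht; apply/negP => /negP ntd; apply: (noComp d t).
- by atoms; distinct.
- by adjacency.
move=> z dz; case/or3P: (pendant_nbr _ _ _ _ _ _ _ Cv Hd dz) => Hz.
- have tz : t != z by apply: contraNneq ntd => ->; adjacency.
  exact: full_clique Hz tz.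
- exact: full_clone Hz.
- exact: opposite_full Hz Ht.
Qed.

Section Pendant.
Variables v1 v2 v3 v4 v5 b d : G.

(** If [d] missed [b], its neighbours would all be full or clones of [v1], hence neighbours of [v2],
    and [d] would be comparable to [v2]. *)
Lemma pendant_opposite : c5 v1 v2 v3 v4 v5 ->
  opposite v1 v2 v3 v4 v5 b -> pendant v1 v2 v3 v4 v5 d -> d -- b.
Proof.
move=> Cv Hb Hd; apply/negP => /negP ndb; apply: (noComp d v2).
- by atoms; distinct.
- by atoms.
move=> z dz; case/or3P: (pendant_nbr _ _ _ _ _ _ _ Cv Hd dz) => Hz.
- by atoms; adjacency.
- by atoms; adjacency.
- by move: dz; rewrite -(opposite_unique _ _ _ _ _ _ _ Cv Hb Hz) (negbTE ndb).
Qed.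

End Pendant.

Lemma pendant_clone2_eq v1 v2 v3 v4 v5 b d x : c5 v1 v2 v3 v4 v5 ->
  opposite v1 v2 v3 v4 v5 b -> pendant v1 v2 v3 v4 v5 d ->
  clone v2 v3 v4 v5 v1 x -> x = v2.
Proof.
move=> Cv Hb Hd Hx; have db := pendant_opposite _ _ _ _ _ _ _ Cv Hb Hd.
apply/eqP/negPn/negP => xv2.
have xv2' : x -- v2 by refine (clone_adj v2 v3 v4 v5 v1 x _ _ _); decide_atoms.
have dx := pendant_clone3 _ _ _ _ _ _ _ Cv Hd Hx.
have [xb|xb] := boolP (x -- b); first by cyc4 x b d v1.
by p2p3 x v2 d b v4.
Qed.

Lemma pendant_clone3_eq v1 v2 v3 v4 v5 d x : c5 v1 v2 v3 v4 v5 ->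
  pendant v1 v2 v3 v4 v5 d -> clone v3 v4 v5 v1 v2 x -> x = v3.
Proof.
move=> Cv Hd Hx; apply/eqP/negPn/negP => xv3.
have xv3' : x -- v3 by refine (clone_adj v3 v4 v5 v1 v2 x _ _ _); decide_atoms.
have dx := pendant_clone2 _ _ _ _ _ _ _ Cv Hd Hx.
by p2p3 x v3 v5 v1 d.
Qed.

(** * Clones in the presence of an opposite vertex *)

Lemma opposite_clone5_eq v1 v2 v3 v4 v5 b x : c5 v1 v2 v3 v4 v5 ->
  opposite v1 v2 v3 v4 v5 b -> clone v5 v1 v2 v3 v4 x -> ~~ (b -- x) ->
  x = v5.
Proof.
move=> Cv Hb Hx bx; apply/eqP/negPn/negP => xv5.
have xv5' : x -- v5 by refine (clone_adj v5 v1 v2 v3 v4 x _ _ _); decide_atoms.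
by p2p3 x v5 v2 v3 b.
Qed.

Lemma opposite_clone2_eq v1 v2 v3 v4 v5 b x : c5 v1 v2 v3 v4 v5 ->
  opposite v1 v2 v3 v4 v5 b -> clone v2 v3 v4 v5 v1 x -> ~~ (b -- x) ->
  x = v2.
Proof.
by move=> Cv Hb Hx bx; apply: (opposite_clone5_eq v1 v5 v4 v3 v2 b);
  decide_atoms.
Qed.

Lemma opposite_clone21 v1 v2 v3 v4 v5 b x y : c5 v1 v2 v3 v4 v5 ->
  opposite v1 v2 v3 v4 v5 b -> clone v2 v3 v4 v5 v1 x -> b -- x ->
  clone v1 v2 v3 v4 v5 y -> y -- x.
Proof.
move=> Cv Hb Hx bx Hy; have nby := opposite_clone1 _ _ _ _ _ _ _ Cv Hb Hy.
have xv2 : x -- v2 by refine (clone_adj v2 v3 v4 v5 v1 x _ _ _); decide_atoms.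
by apply/negP => /negP nyx; cyc6 y v5 v4 b x v2.
Qed.

Lemma opposite_clone23 v1 v2 v3 v4 v5 b x y : c5 v1 v2 v3 v4 v5 ->
  opposite v1 v2 v3 v4 v5 b -> clone v2 v3 v4 v5 v1 x -> b -- x ->
  clone v3 v4 v5 v1 v2 y -> x -- y.
Proof.
move=> Cv Hb Hx bx Hy; have nby := opposite_clone3 _ _ _ _ _ _ _ Cv Hb Hy.
have xv2 : x -- v2 by refine (clone_adj v2 v3 v4 v5 v1 x _ _ _); decide_atoms.
by apply/negP => /negP nyx; cyc4 x b y v2.
Qed.

(** Both clones see [b]; if they were nonadjacent, the detour through [b] would close a C6. *)
Lemma opposite_clone34 v1 v2 v3 v4 v5 b x y : c5 v1 v2 v3 v4 v5 ->
  opposite v1 v2 v3 v4 v5 b -> clone v3 v4 v5 v1 v2 x ->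
  clone v4 v5 v1 v2 v3 y -> x -- y.
Proof.
move=> Cv Hb Hx Hy; have bx := opposite_clone3 _ _ _ _ _ _ _ Cv Hb Hx.
have yb : b -- y.
  by refine (opposite_clone3 v1 v5 v4 v3 v2 b y _ _ _); decide_atoms.
by apply/negP => /negP nyx; cyc6 x v2 v1 v5 y b.
Qed.

(** * The subgraph of non-full vertices: blowup of C5, H1 or H2 *)

Section FullComplement.
Variables v1 v2 v3 v4 v5 : G.

(** The vertex set of the factor H of the join; the full vertices supply the complete factor. *)
Definition core : {set G} := ~: [set x | full v1 v2 v3 v4 v5 x].

Lemma in_core x : (x \in core) = ~~ full v1 v2 v3 v4 v5 x.
Proof. by rewrite !inE. Qed.

Lemma cycle_in_core : [&& v1 \in core, v2 \in core, v3 \in core, v4 \in core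
  & v5 \in core].
Proof. by rewrite !in_core /full !adj_irrefl !andbF. Qed.

Lemma blowup_core : c5 v1 v2 v3 v4 v5 ->
  (forall w1 w2 w3 w4 w5 x,
     c5 w1 w2 w3 w4 w5 -> ~~ opposite w1 w2 w3 w4 w5 x) ->
  blowup (cycle_graph 5) (induced core).
Proof.
move=> Cv noOpp.
have C2 : c5 v2 v3 v4 v5 v1 by decide_atoms.
have C3 : c5 v3 v4 v5 v1 v2 by decide_atoms.
have C4 : c5 v4 v5 v1 v2 v3 by decide_atoms.
have C5 : c5 v5 v1 v2 v3 v4 by decide_atoms.
(* Vertices of [cycle_graph 5] are numbered from 0, so [cl i] describes the clones of the cycle
   vertex with subscript [i.+1]. *)
pose cl := nth (fun=> false) [:: clone v1 v2 v3 v4 v5; clone v2 v3 v4 v5 v1;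
  clone v3 v4 v5 v1 v2; clone v4 v5 v1 v2 v3; clone v5 v1 v2 v3 v4].
exists (fun i : cycle_graph 5 => [set x : induced core | cl i (val x)]); split.
(* The patterns of clones of two different vertices disagree at some cycle vertex. *)
- have clash i j x : i < 5 -> j < 5 -> cl i x -> cl j x -> i = j.
    by case: i => [|[|[|[|[|i]]]]] //; case: j => [|[|[|[|[|j]]]]] // _ _;
      rewrite /cl /= => Hx Hy; exfalso; atoms;
      match goal with H : is_true ?P, H' : is_true (~~ ?P) |- _ =>
        by rewrite H in H' end.
  move=> [x xH]; have nx := xH; rewrite in_core in nx.
  suff [i i5 Hi] : exists2 i, i < 5 & cl i x.
    exists (Ordinal i5); split=> [|j]; rewrite inE //= => Hj.
    by apply: ord_inj; apply: (clash _ _ x i5 (ltn_ord j) Hi Hj).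
  case/or4P: (blowup_cases noOpp _ _ _ _ _ x Cv nx) => [Hx|Hx|Hx|/orP[]Hx].
  - by exists 0.
  - by exists 1.
  - by exists 2.
  - by exists 3.
  - by exists 4.
- have/and5P[n1 n2 n3 n4 n5] := cycle_in_core.
  case=> [[|[|[|[|[|i]]]]] //= li]; apply/set0Pn.
  + by exists (exist _ v1 n1); rewrite inE /cl /=; decide_atoms.
  + by exists (exist _ v2 n2); rewrite inE /cl /=; decide_atoms.
  + by exists (exist _ v3 n3); rewrite inE /cl /=; decide_atoms.
  + by exists (exist _ v4 n4); rewrite inE /cl /=; decide_atoms.
  + by exists (exist _ v5 n5); rewrite inE /cl /=; decide_atoms.
- case=> [[|[|[|[|[|i]]]]] //= li] [x xH] [y yH];
    rewrite !inE /cl -val_eqE /= => Hx Hy xy.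
  + exact: clone_clique Cv Hx Hy xy.
  + exact: clone_clique C2 Hx Hy xy.
  + exact: clone_clique C3 Hx Hy xy.
  + exact: clone_clique C4 Hx Hy xy.
  + exact: clone_clique C5 Hx Hy xy.
have K1 := fun x y => clone_complete noOpp _ _ _ _ _ x y Cv.
have K2 := fun x y => clone_complete noOpp _ _ _ _ _ x y C2.
have K3 := fun x y => clone_complete noOpp _ _ _ _ _ x y C3.
have K4 := fun x y => clone_complete noOpp _ _ _ _ _ x y C4.
have K5 := fun x y => clone_complete noOpp _ _ _ _ _ x y C5.
have N1 := fun x y => clone_anti _ _ _ _ _ x y Cv.
have N2 := fun x y => clone_anti _ _ _ _ _ x y C2.
have N3 := fun x y => clone_anti _ _ _ _ _ x y C3.
have N4 := fun x y => clone_anti _ _ _ _ _ x y C4.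
have N5 := fun x y => clone_anti _ _ _ _ _ x y C5.
case=> [[|[|[|[|[|i]]]]] //= li]; case=> [[|[|[|[|[|j]]]]] //= lj] _;
  move=> [x xH] [y yH]; rewrite !inE /cl /= => Hx Hy;
  rewrite /induced_rel /=;
  first [ exact: K1 Hx Hy | exact: K2 Hx Hy | exact: K3 Hx Hy
        | exact: K4 Hx Hy | exact: K5 Hx Hy | exact: N1 Hx Hy
        | exact: N2 Hx Hy | exact: N3 Hx Hy | exact: N4 Hx Hy
        | exact: N5 Hx Hy | rewrite adj_sym;
          first [ exact: K1 Hy Hx | exact: K2 Hy Hx | exact: K3 Hy Hx
                | exact: K4 Hy Hx | exact: K5 Hy Hx | exact: N1 Hy Hx
                | exact: N2 Hy Hx | exact: N3 Hy Hx | exact: N4 Hy Hx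
                | exact: N5 Hy Hx ]].
Qed.

Variables b d : G.

Variant pendant_spec x : Prop :=
| PendV2 of x = v2 | PendV3 of x = v3 | PendV4 of x = v4 | PendV5 of x = v5
| PendOpp of x = b | PendSelf of x = d
| PendClone of clone v1 v2 v3 v4 v5 x & d -- x & ~~ (b -- x).

Lemma pendant_cases x : c5 v1 v2 v3 v4 v5 -> opposite v1 v2 v3 v4 v5 b ->
  pendant v1 v2 v3 v4 v5 d -> x \in core -> pendant_spec x.
Proof.
move=> Cv Hb Hd; rewrite in_core => nx.
have Cr : c5 v1 v5 v4 v3 v2 by decide_atoms.
have Hbr : opposite v1 v5 v4 v3 v2 b by decide_atoms.
have Hdr : pendant v1 v5 v4 v3 v2 d by decide_atoms.
case: (opposite_cases v1 v2 v3 v4 v5 b x Cv Hb) => Hx.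
- by rewrite Hx in nx.
- constructor=> //; first exact: pendant_clone1 Hd Hx.
  exact: opposite_clone1 Hb Hx.
- by constructor; apply: (pendant_clone2_eq _ _ _ _ _ _ _ _ Cv Hb Hd).
- by constructor; apply: (pendant_clone3_eq _ _ _ _ _ _ _ Cv Hd).
- constructor; apply: (pendant_clone3_eq _ _ _ _ _ _ _ Cr Hdr).
  by decide_atoms.
- constructor; apply: (pendant_clone2_eq _ _ _ _ _ _ _ _ Cr Hbr Hdr).
  by decide_atoms.
- by constructor.
- by constructor; apply: (pendant_pendant v1 v2 v3 v4 v5).
Qed.

Lemma class_H1_core : c5 v1 v2 v3 v4 v5 -> opposite v1 v2 v3 v4 v5 b ->
  pendant v1 v2 v3 v4 v5 d -> class_H1 (induced core).
Proof.
move=> Cv Hb Hd; have db := pendant_opposite _ _ _ _ _ _ _ Cv Hb Hd.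
have cases x (xH : x \in core) := pendant_cases x Cv Hb Hd xH.
have clq x y := clone_clique v1 v2 v3 v4 v5 x y Cv.
have/and5P[n1 n2 n3 n4 n5] := cycle_in_core.
have nb : b \in core.
  by rewrite in_core; apply: contraL Hb => /and5P[v1b _ _ _ _];
     rewrite /opposite v1b.
have nd : d \in core.
  by rewrite in_core; apply: contraL Hd => /and5P[_ v2d _ _ _];
     rewrite /pendant v2d andbF.
have H1 : clone v1 v2 v3 v4 v5 v1 by decide_atoms.
atoms.
(* The triangle u1 u2 u5 is [v4 v3 b]; attached to its corners are u4, u3, u6, namely [v5], [v2],
   [d]; the clique S consists of the clones of [v1]. *)
exists (exist _ v4 n4), (exist _ v3 n3), (exist _ v2 n2), (exist _ v5 n5),
  (exist _ b nb), (exist _ d nd),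
  [set x : induced core | clone v1 v2 v3 v4 v5 (val x)]; split.
- move=> [x xH]; rewrite /= !inE -!val_eqE /=.
  by case: (cases x xH) => [->|->|->|->|->|->|Hx dx bx]; atoms;
    rewrite /clone; evaluate.
- by apply/set0Pn; exists (exist _ v1 n1); rewrite inE /clone /=; evaluate.
move=> [x xH] [y yH]; transitivity (x -- y); first by [].
rewrite /simple_rel /= !inE -!val_eqE /=.
case: (cases x xH) => [->|->|->|->|->|->|Hx dx bx];
case: (cases y yH) => [->|->|->|->|->|->|Hy dy hy];
  try (have [<-|xy] := eqVneq x y; last have xy' := clq x y Hx Hy xy);
  atoms; rewrite /clone; evaluate; done.
Qed.

Lemma class_H2_core : c5 v1 v2 v3 v4 v5 -> opposite v1 v2 v3 v4 v5 b ->
  (forall x, ~~ pendant v1 v2 v3 v4 v5 x) ->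
  (forall x, clone v5 v1 v2 v3 v4 x -> ~~ (b -- x)) ->
  class_H2 (induced core).
Proof.
move=> Cv Hb nopend nb5.
have C2 : c5 v2 v3 v4 v5 v1 by decide_atoms.
have C3 : c5 v3 v4 v5 v1 v2 by decide_atoms.
have C4 : c5 v4 v5 v1 v2 v3 by decide_atoms.
(* A clone of [v2] or [v5] missed by [b] is that vertex itself. Hence [v5] is its only clone, and
   the clones of [v2] other than [v2] all see [b]. *)
have cases x : x \in core ->
  [\/ x = v5, x = b, x = v2 | [\/ clone v4 v5 v1 v2 v3 x /\ b -- x,
     clone v3 v4 v5 v1 v2 x /\ b -- x,
     [/\ clone v2 v3 v4 v5 v1 x, b -- x & x -- v2]
   | clone v1 v2 v3 v4 v5 x /\ ~~ (b -- x)]].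
  rewrite in_core => nx.
  case: (opposite_cases v1 v2 v3 v4 v5 b x Cv Hb) => Hx.
  - by rewrite Hx in nx.
  - by do 2 apply: Or44; split=> //; apply: opposite_clone1 Hb Hx.
  - have [bx|bx] := boolP (b -- x).
      apply: Or44; apply: Or43; split=> //; apply: clone_adj C2 Hx _.
      by atoms; distinct.
    by apply: Or43; apply: opposite_clone2_eq Hb Hx bx.
  - by apply: Or44; apply: Or42; split=> //; apply: opposite_clone3 Hb Hx.
  - apply: Or44; apply: Or41; split=> //.
    by refine (opposite_clone3 v1 v5 v4 v3 v2 b x _ _ _); decide_atoms.
  - by apply: Or41; apply: opposite_clone5_eq Hb Hx (nb5 x Hx).
  - exact: Or42.
  - by case/negP: (nopend x).
have clq1 x y := clone_clique _ _ _ _ _ x y Cv.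
have clq2 x y := clone_clique _ _ _ _ _ x y C2.
have clq3 x y := clone_clique _ _ _ _ _ x y C3.
have clq4 x y := clone_clique _ _ _ _ _ x y C4.
have anti13 x y := clone_anti _ _ _ _ _ x y Cv.
have anti24 x y := clone_anti _ _ _ _ _ x y C2.
have anti41 x y := clone_anti _ _ _ _ _ x y C4.
have comp21 x y := opposite_clone21 _ _ _ _ _ b x y Cv Hb.
have comp23 x y := opposite_clone23 _ _ _ _ _ b x y Cv Hb.
have comp34 x y := opposite_clone34 _ _ _ _ _ b x y Cv Hb.
have/and5P[n1 n2 n3 n4 n5] := cycle_in_core.
have nb : b \in core.
  by rewrite in_core; apply: contraL Hb => /and5P[v1b _ _ _ _];
     rewrite /opposite v1b.
pose C i := nth (fun=> false) [:: clone v1 v2 v3 v4 v5;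
  fun x => clone v2 v3 v4 v5 v1 x && (b -- x);
  clone v3 v4 v5 v1 v2; clone v4 v5 v1 v2 v3] i.
clear C2 C3 C4; atoms.
(* The independent set u, v, w is [v5], [b], [v2]. S1, S2, S4 are the clones of [v4], [v3], [v1],
   and S3 those clones of [v2] that see [b], possibly none. *)
exists (exist _ v5 n5), (exist _ b nb), (exist _ v2 n2),
  [set x : induced core | C 3 (val x)], [set x : induced core | C 2 (val x)],
  [set x : induced core | C 1 (val x)], [set x : induced core | C 0 (val x)].
split.
- move=> [x xH]; rewrite /= !inE -!val_eqE /C /=.
  by case: (cases x xH) => [->|->|->|[[Hx bx]|[Hx bx]|[Hx bx xv2]|[Hx bx]]];
    atoms; rewrite /clone; evaluate; rewrite ?andbF.
- split; apply/set0Pn; [exists (exist _ v4 n4)|exists (exist _ v3 n3)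
    |exists (exist _ v1 n1)]; by rewrite inE /C /clone /=; evaluate.
move=> [x xH] [y yH]; transitivity (x -- y); first by [].
rewrite /simple_rel /= !inE -!val_eqE /C /=.
case: (cases x xH) => [->|->|->|[[Hx bx]|[Hx bx]|[Hx bx xv2]|[Hx bx]]];
case: (cases y yH) => [->|->|->|[[Hy hy]|[Hy hy]|[Hy hy yv2]|[Hy hy]]];
  try (have [<-|xy] := eqVneq x y;
       last (first [ have xy' := clq1 x y Hx Hy xy
                   | have xy' := clq2 x y Hx Hy xy
                   | have xy' := clq3 x y Hx Hy xy
                   | have xy' := clq4 x y Hx Hy xy ]));
  try first
    [ have xy' := anti13 x y Hx Hy | have xy' := anti13 y x Hy Hx
    | have xy' := anti24 x y Hx Hy | have xy' := anti24 y x Hy Hx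
    | have xy' := anti41 x y Hx Hy | have xy' := anti41 y x Hy Hx
    | have xy' := comp21 x y Hx bx Hy | have xy' := comp21 y x Hy hy Hx
    | have xy' := comp23 x y Hx bx Hy | have xy' := comp23 y x Hy hy Hx
    | have xy' := comp34 x y Hx Hy | have xy' := comp34 y x Hy Hx ];
  atoms; rewrite /clone; evaluate; by rewrite ?(andbF, orbF, orbT).
Qed.

Lemma full_universal_blowup x y : c5 v1 v2 v3 v4 v5 ->
  (forall w1 w2 w3 w4 w5 x,
     c5 w1 w2 w3 w4 w5 -> ~~ opposite w1 w2 w3 w4 w5 x) ->
  full v1 v2 v3 v4 v5 x -> x != y -> x -- y.
Proof.
move=> Cv noOpp Hx xy; have [Hy|ny] := boolP (full v1 v2 v3 v4 v5 y).
  exact: full_clique Hx Hy xy.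
exact: full_clone_any Hx (blowup_cases noOpp _ _ _ _ _ y Cv ny).
Qed.

Lemma full_universal_opposite x y : c5 v1 v2 v3 v4 v5 ->
  opposite v1 v2 v3 v4 v5 b -> full v1 v2 v3 v4 v5 x -> x != y -> x -- y.
Proof.
move=> Cv Hb Hx xy; case: (opposite_cases v1 v2 v3 v4 v5 b y Cv Hb) => Hy;
  try by apply: (full_clone_any _ _ _ _ _ _ _ Cv Hx); rewrite Hy ?orbT.
- exact: full_clique Hx Hy xy.
- by rewrite Hy; apply: opposite_full Hb Hx.
- exact: pendant_full Hy Hx.
Qed.

End FullComplement.

End Structure.

(** * From forbidden induced subgraphs to the patterns, and chordality *)

(** [isomorphic] asks for a map out of the induced subgraph, so the embedding is restricted to its
    image and inverted there. *)
Lemma inj_isomorphic_induced (G H : sgraph) (h : H -> G) :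
  injective h -> (forall x y, (h x -- h y) = (x -- y)) ->
  exists A : {set G}, isomorphic (induced A) H.
Proof.
move=> h_inj h_adj; exists [set h x | x : H].
have hP (x : H) : h x \in [set h x | x : H] by apply: imset_f.
pose g (x : H) : induced [set h x | x : H] := exist _ (h x) (hP x).
have g_inj : injective g by move=> x y /(congr1 val)/h_inj.
have [f gK fK] : bijective g.
  by apply: inj_card_bij => //; rewrite card_sig leq_imset_card.
exists f; first by exists g.
by move=> x y; rewrite -[in RHS](fK x) -[in RHS](fK y) -h_adj.
Qed.

Section ForbiddenSubgraphs.
Variable G : sgraph.
Hypothesis Gfree :
  free (fun F => [\/ F = disjoint_union (path_graph 2) (path_graph 3),
                     F = cycle_graph 4
                   | F = cycle_graph 6]) G.

Ltac decide_uniq :=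
  rewrite /= !inE !negb_or;
  repeat match goal with |- is_true (_ && _) => apply/andP; split end;
  solve [ exact isT | distinct ].

Lemma nth_ord_inj n (w : seq G) (x0 : G) : uniq w -> size w = n ->
  injective (fun i : 'I_n => nth x0 w i).
Proof.
move=> w_uniq sw i j /eqP; rewrite nth_uniq ?sw // => /eqP; exact: val_inj.
Qed.

Lemma free_no_P2P3 : no_P2P3 G.
Proof.
move=> p q r s t pq rs st rt nrt npr nps npt nqr nqs nqt.
pose H := disjoint_union (path_graph 2) (path_graph 3).
pose w := [:: p; q; r; s; t].
have w_uniq : uniq w by decide_uniq.
(* The P3 occupies positions 2 to 4 of [w], hence the shift by two. *)
pose h (x : H) : G :=
  match x with inl i => nth p w i | inr i => nth p w i.+2 end.
have h_adj x y : (h x -- h y) = (x -- y).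
  by case: x => [[[|[|i]] //= li]|[[|[|[|i]]] //= li]];
     case: y => [[[|[|j]] //= lj]|[[|[|[|j]]] //= lj]];
     evaluate.
apply: (Gfree H (Or31 _ _ erefl)); apply: inj_isomorphic_induced h_adj.
case=> [] i [] j /eqP; rewrite nth_uniq //;
  try by case: i j => [[|[|[|i]]] ?] [[|[|[|j]]] ?].
- by move=> /eqP/val_inj ->.
- by move=> /eqP[] /val_inj ->.
Qed.

Lemma free_no_C4 : no_C4 G.
Proof.
move=> p q r s pq qr rs sp pr qs npr nqs.
have w_uniq : uniq [:: p; q; r; s] by decide_uniq.
apply: (Gfree (cycle_graph 4) (Or32 _ _ erefl)).
refine (inj_isomorphic_induced G (cycle_graph 4) _
  (nth_ord_inj 4 _ p w_uniq erefl) _).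
by case=> [[|[|[|[|i]]]] //= li]; case=> [[|[|[|[|j]]]] //= lj]; evaluate.
Qed.

Lemma free_no_C6 : no_C6 G.
Proof.
move=> p q r s t u pq qr rs st tu up pr ps pt qs qt qu' rt ru su.
have w_uniq : uniq [:: p; q; r; s; t; u] by decide_uniq.
apply: (Gfree (cycle_graph 6) (Or33 _ _ erefl)).
refine (inj_isomorphic_induced G (cycle_graph 6) _
  (nth_ord_inj 6 _ p w_uniq erefl) _).
by case=> [[|[|[|[|[|[|i]]]]]] //= li]; case=> [[|[|[|[|[|[|j]]]]]] //= lj];
  evaluate.
Qed.

Lemma no_c5_chordal : (forall v1 v2 v3 v4 v5 : G, ~~ c5 v1 v2 v3 v4 v5) ->
  chordal G.
Proof.
move=> noC5 H [t t4 ->] [A [f [g gK fK] f_adj]].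
have t0 : 0 < t by apply: leq_trans t4.
(* Numbers the cycle by naturals; the default vertex 0 is taken only for [k] at least [t]. *)
pose h (k : nat) : G := val (g (insubd (Ordinal t0) k)).
have h_adj i j : i < t -> j < t ->
    (h i -- h j) = (i != j) && ((i.+1 %% t == j) || (j.+1 %% t == i)).
  move=> it jt.
  set i' := insubd (Ordinal t0) i; set j' := insubd (Ordinal t0) j.
  transitivity (g i' -- g j'); first by [].
  by rewrite -f_adj !fK /adj /= /simple_rel -val_eqE /= !val_insubd it jt.
have t7 : [|| t == 4, t == 5, t == 6 | 6 < t].
  by case: t t4 {t0 f g gK fK f_adj h h_adj} => [|[|[|[|[|[|[|t]]]]]]].
case/or4P: t7 => [/eqP E|/eqP E|/eqP E|t7].
- subst t; apply: (Gfree (cycle_graph 4) (Or32 _ _ erefl)).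
  by exists A, f => //; exists g.
- subst t; apply: (negP (noC5 (h 0) (h 1) (h 2) (h 3) (h 4))).
  by rewrite /c5 !h_adj.
- subst t; apply: (Gfree (cycle_graph 6) (Or33 _ _ erefl)).
  by exists A, f => //; exists g.
have lt7 k : k < 7 -> k < t by move=> k7; apply: leq_trans t7.
(* In a cycle of length at least 7 the successor of an index below 6 does not wrap around. So the
   vertices 0, 1 and 3, 4, 5 induce a P2+P3. *)
have h_adj7 i j : i < 6 -> j < 6 -> (h i -- h j) = (i.+1 == j) || (j.+1 == i).
  move=> i6 j6; rewrite h_adj ?lt7 ?modn_small ?lt7 // 1?ltnW //.
  by have [->|] := eqVneq i j => //=; rewrite (gtn_eqF (ltnSn j)).
have h_neq : h 3 != h 5.
  apply/eqP => E; have := h_adj7 3 2 isT isT.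
  by rewrite E h_adj7.
by apply: (free_no_P2P3 (h 0) (h 1) (h 3) (h 4) (h 5)); rewrite ?h_adj7.
Qed.

End ForbiddenSubgraphs.

(** * Splitting off universal vertices, and assembling the cases *)

Lemma join_complete (G : sgraph) (A : {set G}) :
  (forall x y, x \in A -> x != y -> x -- y) ->
  isomorphic G (join (induced (~: A)) (complete_graph #|A|)).
Proof.
move=> A_univ; pose J := join (induced (~: A)) (complete_graph #|A|).
pose g (x : J) : G := match x with inl y => val y | inr i => enum_val i end.
have gA (i : 'I_#|A|) : enum_val i \in A by apply: enum_valP.
have gNA (y : induced (~: A)) : val y \notin A by have := valP y; rewrite inE.
have gN (y : induced (~: A)) (i : 'I_#|A|) : val y != enum_val i.
  by apply/eqP => E; move: (gNA y); rewrite E gA.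
have g_inj : injective g.
  case=> [x|i] [y|j] //= E.
  - by congr inl; apply: val_inj.
  - by case/eqP: (gN x j).
  - by case/eqP: (gN y i).
  - by rewrite (enum_val_inj E).
have g_adj x y : (g x -- g y) = (x -- y).
  case: x y => [x|i] [y|j] //=.
  - by rewrite adj_sym A_univ // eq_sym gN.
  - by rewrite A_univ // eq_sym gN.
  - have [->|ij] := eqVneq i j; first by rewrite adj_irrefl /simple_rel eqxx.
    rewrite /simple_rel ij /=.
    by apply: A_univ => //; rewrite (inj_eq enum_val_inj).
have [f gK fK] : bijective g.
  apply: inj_card_bij => //.
  by rewrite card_sum card_sig card_ord addnC cardsC.
exists f; first by exists g.
by move=> x y; rewrite -g_adj !fK.
Qed.

Theorem theorem1 (G : sgraph)
    (Gconn : connected G)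
    (Gfree : free (fun F => [\/ F = disjoint_union (path_graph 2) (path_graph 3),
                                F = cycle_graph 4
                              | F = cycle_graph 6]) G) :
  [\/ chordal G,
      exists x y : G, comparable_vertices x y
    | exists (H : sgraph) (p : nat),
        [\/ blowup (cycle_graph 5) H, class_H1 H | class_H2 H] /\
        isomorphic G (join H (complete_graph p))].
Proof.
have noP := free_no_P2P3 G Gfree; have noC4 := free_no_C4 G Gfree.
have noC6 := free_no_C6 G Gfree.
have [/existsP[x /existsP[y xy]]|noCmp] :=
  boolP [exists x : G, exists y : G, comparable_vertices x y].
  by apply: Or32; exists x, y.
have noComp : no_comparable G.
  move=> x y xy nxy Nxy; case/negP: noCmp.
  apply/existsP; exists x; apply/existsP; exists y.
  rewrite /comparable_vertices xy nxy; apply/orP; left.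
  by apply/subsetP => z; rewrite !inE; apply: Nxy.
have [/existsP[[[[[v1 v2] v3] v4] v5] /= Cv]|noC5] :=
  boolP [exists w : G * G * G * G * G,
    let: (v1, v2, v3, v4, v5) := w in c5 v1 v2 v3 v4 v5]; last first.
  apply: Or31; apply: no_c5_chordal => // v1 v2 v3 v4 v5.
  by apply: contraNN noC5 => Cv; apply/existsP; exists (v1, v2, v3, v4, v5).
apply: Or33.
(* Common end of all non-chordal cases: once the full vertices are universal, they split off as the
   complete factor. *)
have join_core w1 w2 w3 w4 w5 :
    (forall x y : G, full w1 w2 w3 w4 w5 x -> x != y -> x -- y) ->
    [\/ blowup (cycle_graph 5) (induced (core G w1 w2 w3 w4 w5)),
        class_H1 (induced (core G w1 w2 w3 w4 w5))
      | class_H2 (induced (core G w1 w2 w3 w4 w5))] ->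
    exists (H : sgraph) (p : nat),
        [\/ blowup (cycle_graph 5) H, class_H1 H | class_H2 H] /\
        isomorphic G (join H (complete_graph p)).
  move=> univ Hcore; exists (induced (core G w1 w2 w3 w4 w5)).
  exists #|[set x | full w1 w2 w3 w4 w5 x]|; split=> //.
  by apply: join_complete => x y; rewrite inE; apply: univ.
(* The search covers every induced C5, since [clone_complete] uses the absence of opposite vertices
   on a modified cycle. *)
have [/existsP[[[[[[w1 w2] w3] w4] w5] b] /andP[Cw Hb]]|noOpp'] :=
  boolP [exists w : G * G * G * G * G * G,
    let: (v1, v2, v3, v4, v5, b) := w in
    c5 v1 v2 v3 v4 v5 && opposite v1 v2 v3 v4 v5 b]; last first.
  have noOpp (w1 w2 w3 w4 w5 b : G) :
      c5 w1 w2 w3 w4 w5 -> ~~ opposite w1 w2 w3 w4 w5 b.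
    move=> Cw; apply: contraNN noOpp' => Hb.
    by apply/existsP; exists (w1, w2, w3, w4, w5, b); rewrite Cw.
  apply: (join_core v1 v2 v3 v4 v5).
    by move=> x y; apply: full_universal_blowup.
  by apply: Or31; apply: blowup_core.
have Cr : c5 w1 w5 w4 w3 w2 by decide_atoms.
have Hr : opposite w1 w5 w4 w3 w2 b by decide_atoms.
have univ x y : full w1 w2 w3 w4 w5 x -> x != y -> x -- y.
  exact: full_universal_opposite Cw Hb.
have univr x y : full w1 w5 w4 w3 w2 x -> x != y -> x -- y.
  exact: full_universal_opposite Cr Hr.
have [/existsP[d Hd]|nopend'] := boolP [exists d, pendant w1 w2 w3 w4 w5 d].
  apply: (join_core w1 w2 w3 w4 w5) => //.
  by apply: Or32; apply: class_H1_core Cw Hb Hd.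
have nopend x : ~~ pendant w1 w2 w3 w4 w5 x.
  by apply: contraNN nopend' => Hx; apply/existsP; exists x.
(* [class_H2_core] wants [b] to miss all clones of the last cycle vertex. If [b] sees a clone of
   [w5], it misses those of [w2], and the cycle reversed about [w1] is used. *)
have [/existsP[x /andP[Hx bx]]|noadj] :=
  boolP [exists x, clone w5 w1 w2 w3 w4 x && (b -- x)].
- apply: (join_core w1 w5 w4 w3 w2) => //.
  apply: Or33.
  apply: (class_H2_core G noP noC4 noC6 noComp _ _ _ _ _ _ Cr Hr) => y.
    by apply: contraNN (nopend y) => Hy; decide_atoms.
  move=> Hy; apply/negP => yb.
  by refine (opposite_clone25 G noC4 _ _ _ _ _ b x y Cw Hx _ bx yb Hb);
    decide_atoms.
- apply: (join_core w1 w2 w3 w4 w5) => //.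
  apply: Or33.
  apply: (class_H2_core G noP noC4 noC6 noComp _ _ _ _ _ _ Cw Hb) => // x Hx.
  by apply: contraNN noadj => bx; apply/existsP; exists x; rewrite Hx.
Qed.
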